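(* The unification problem for schematic terms in $\mathrm{PRL}^\iota$ is undecidable: there is no algorithm which, given a finite set $\{t_1,\ldots,t_\alpha\}$ of schematic terms in $\mathrm{PRL}^\iota$ (together with their defining theory), decides whether this set is unifiable.
   Context: Parameters range over natural numbers; a parameter assignment $\sigma$ maps parameters to numerals $\bar0,s(\bar0),\ldots$. Schematic individual terms are built from first-order function symbols, first-order variables, and schematic term symbols $\hat t(s_1,\ldots,s_i,r_1,\ldots,r_j)$ (individual arguments $s_l$, numeric arguments $r_l$), where each schematic symbol is defined in an $\omega\iota$-theory by primitive recursion on its last numeric argument: $\hat t(\vec x,\vec n,s(m))=\hat t_S\{z\leftarrow\hat t(\vec x,\vec n,m)\}$, $\hat t(\vec x,\vec n,\bar0)=\hat t_B$, with $\hat t_S,\hat t_B$ using only smaller schematic symbols. $\sigma(t){\downarrow}$ is the first-order term obtained by evaluating the numeric arguments under $\sigma$ and unfolding the definitions. A finite set $\{t_1,\ldots,t_\alpha\}$ of schematic terms is unifiable if for every parameter assignment $\sigma$ the set $\{\sigma(t_1){\downarrow},\ldots,\sigma(t_\alpha){\downarrow}\}$ is first-order unifiable. Fix an individual constant $0_\iota$ and a unary function symbol $\mathrm{suc}$, and let $\mathrm{Num}^\iota=\{\mathrm{suc}^k(0_\iota)\mid k\ge0\}$. $\mathrm{PRL}^\iota$ denotes the class of schematic terms (over $\omega\iota$-theories with first-order function symbols $0_\iota,\mathrm{suc}$) obtained by translating primitive recursive definitions into such theories (e.g. $\widehat{num}(x,\bar0)=0_\iota$, $\widehat{num}(x,s(n))=\mathrm{suc}(\widehat{num}(x,n))$,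 and recursion on numeric arguments with individual arguments instantiated by such numeral-representing terms), so that every primitive recursive function $f$ of arity $k$ is represented by a term $t_f$ with parameters $n_1,\ldots,n_k$ satisfying $\sigma(t_f){\downarrow}=\mathrm{suc}^{f(\sigma(n_1),\ldots,\sigma(n_k))}(0_\iota)$, and every term of $\mathrm{PRL}^\iota$ evaluates under every $\sigma$ to an element of $\mathrm{Num}^\iota$. *)

(* Defs.v *)
From Stdlib Require List.
From mathcomp Require Import all_boot.

Set Implicit Arguments.
Unset Strict Implicit.
Unset Printing Implicit Defensive.

(* Function symbols and variables are named by numbers; a function symbol is
   identified by its name together with the number of its arguments. *)
Inductive fterm : Type :=
| FVar (x : nat)
| FFun (f : nat) (args : seq fterm).

Fixpoint fsubst (theta : nat -> fterm) (t : fterm) : fterm :=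
  match t with
  | FVar x => theta x
  | FFun f args => FFun f [seq fsubst theta a | a <- args]
  end.

Definition fo_unifiable (ts : seq fterm) : Prop :=
  exists theta : nat -> fterm,
    forall t u, List.In t ts -> List.In u ts -> fsubst theta t = fsubst theta u.

(* Numeric terms (sort omega); [NPar n] is a parameter and [NApp f] the
   application of the [f]-th schematic symbol of sort omega. *)
Inductive nterm : Type :=
| NZero
| NSucc (t : nterm)
| NPar (n : nat)
| NApp (f : nat) (args : seq nterm).

(* Individual terms (sort iota); [SApp t ss rs] applies the [t]-th schematic
   symbol of sort iota to individual arguments [ss] and numeric arguments
   [rs]. *)
Inductive sterm : Type :=
| SVar (x : nat)
| SFun (f : nat) (args : seq sterm)
| SApp (t : nat) (ss : seq sterm) (rs : seq nterm).

(* Definition of a schematic symbol of sort omega: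
     f(n_0,..,n_{j-1}, 0)   = base,
     f(n_0,..,n_{j-1}, s m) = step {z <- f(n_0,..,n_{j-1}, m)},  j = nd_arity.
   In the bodies, n_k is [NPar k], m is [NPar j] and z is [NPar j.+1]. *)
Record ndef : Type := NDef {
  nd_arity : nat;
  nd_base : nterm;
  nd_step : nterm
}.

(* Definition of a schematic symbol of sort iota:
     t(x_0,..,x_{i-1}, n_0,..,n_{j-1}, 0)   = base,
     t(x_0,..,x_{i-1}, n_0,..,n_{j-1}, s m) =
       step {z <- t(x_0,..,x_{i-1}, n_0,..,n_{j-1}, m)},
   with i = id_iarity and j = id_narity.  In the bodies, x_k is [SVar k],
   z is [SVar i], n_k is [NPar k] and m is [NPar j]. *)
Record idef : Type := IDef {
  id_iarity : nat;
  id_narity : nat;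
  id_base : sterm;
  id_step : sterm
}.

(* The schematic symbols of each sort are listed in increasing order; those of
   sort omega are smaller than those of sort iota. *)
Record theory : Type := Theory {
  th_num : seq ndef;
  th_ind : seq idef
}.

(* [nars] lists the arities of the available symbols of sort omega, [P]
   is the set of available parameters. *)
Fixpoint wf_nterm (nars : seq nat) (P : pred nat) (t : nterm) : bool :=
  match t with
  | NZero => true
  | NSucc t => wf_nterm nars P t
  | NPar n => P n
  | NApp f args =>
      [&& f < size nars, size args == nth 0 nars f & all (wf_nterm nars P) args]
  end.

(* [sg f k] holds if the name [f] denotes a first-order function symbol of
   arity [k]; [iars] lists the (individual, numeric) arities of the available
   symbols of sort iota, [X] is the set of available individual variables. *)
Fixpoint wf_sterm (sg : nat -> nat -> bool) (nars : seq nat)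
    (iars : seq (nat * nat)) (X P : pred nat) (t : sterm) : bool :=
  match t with
  | SVar x => X x
  | SFun f args =>
      sg f (size args) && all (wf_sterm sg nars iars X P) args
  | SApp t ss rs =>
      [&& t < size iars, (size ss, size rs) == nth (0, 0) iars t,
          all (wf_sterm sg nars iars X P) ss & all (wf_nterm nars P) rs]
  end.

Definition nars (D : seq ndef) : seq nat := [seq (nd_arity d).+1 | d <- D].
Definition iars (E : seq idef) : seq (nat * nat) :=
  [seq (id_iarity d, (id_narity d).+1) | d <- E].

Definition wf_ndef (D : seq ndef) (d : ndef) : bool :=
  let j := nd_arity d in
  wf_nterm (nars D) (fun n => n < j) (nd_base d) &&
  wf_nterm (nars D) (fun n => n < j.+2) (nd_step d).

Definition wf_idef (sg : nat -> nat -> bool) (D : seq ndef) (E : seq idef)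
    (d : idef) : bool :=
  let i := id_iarity d in
  let j := id_narity d in
  wf_sterm sg (nars D) (iars E) (fun x => x < i) (fun n => n < j) (id_base d) &&
  wf_sterm sg (nars D) (iars E) (fun x => x < i.+1) (fun n => n < j.+1)
    (id_step d).

(* Each definition only uses the schematic symbols defined before it. *)
Fixpoint wf_defs (A : Type) (ok : seq A -> A -> bool) (prev s : seq A) : bool :=
  match s with
  | [::] => true
  | d :: s' => ok prev d && wf_defs ok (rcons prev d) s'
  end.

Definition wf_theory (sg : nat -> nat -> bool) (T : theory) : bool :=
  wf_defs wf_ndef [::] (th_num T) &&
  wf_defs (wf_idef sg (th_num T)) [::] (th_ind T).

(* Numerals are identified with natural numbers.  [NI] (resp. [II]) lists the
   functions computed by the schematic symbols of sort omega (resp. iota). *)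
Fixpoint neval (NI : seq (seq nat -> nat)) (sigma : nat -> nat) (t : nterm)
    : nat :=
  match t with
  | NZero => 0
  | NSucc t => (neval NI sigma t).+1
  | NPar n => sigma n
  | NApp f args => nth (fun=> 0) NI f [seq neval NI sigma a | a <- args]
  end.

Fixpoint nunfold (NI : seq (seq nat -> nat)) (d : ndef) (ns : seq nat) (m : nat)
    : nat :=
  match m with
  | 0 => neval NI (nth 0 ns) (nd_base d)
  | m.+1 => neval NI (nth 0 (ns ++ [:: m; nunfold NI d ns m])) (nd_step d)
  end.

Definition ndef_fun NI (d : ndef) (v : seq nat) : nat :=
  nunfold NI d (take (nd_arity d) v) (nth 0 v (nd_arity d)).

Definition num_funs (D : seq ndef) : seq (seq nat -> nat) :=
  foldl (fun NI d => rcons NI (ndef_fun NI d)) [::] D.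

(* [rho] is the substitution applied to the individual variables. *)
Fixpoint seval NI (II : seq (seq fterm -> seq nat -> fterm))
    (sigma : nat -> nat) (rho : nat -> fterm) (t : sterm) : fterm :=
  match t with
  | SVar x => rho x
  | SFun f args => FFun f [seq seval NI II sigma rho a | a <- args]
  | SApp t ss rs =>
      nth (fun _ _ => FVar 0) II t [seq seval NI II sigma rho s | s <- ss]
        [seq neval NI sigma r | r <- rs]
  end.

Fixpoint iunfold NI (II : seq (seq fterm -> seq nat -> fterm)) (d : idef)
    (xs : seq fterm) (ns : seq nat) (m : nat) : fterm :=
  match m with
  | 0 => seval NI II (nth 0 ns) (nth (FVar 0) xs) (id_base d)
  | m.+1 => seval NI II (nth 0 (ns ++ [:: m]))
              (nth (FVar 0) (xs ++ [:: iunfold NI II d xs ns m])) (id_step d)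
  end.

Definition idef_fun NI (II : seq (seq fterm -> seq nat -> fterm)) (d : idef)
    (xs : seq fterm) (v : seq nat) : fterm :=
  iunfold NI II d xs (take (id_narity d) v) (nth 0 v (id_narity d)).

Definition ind_funs NI (E : seq idef) : seq (seq fterm -> seq nat -> fterm) :=
  foldl (fun II d => rcons II (idef_fun NI II d)) [::] E.

(* The first-order term written sigma(t) followed by a down arrow. *)
Definition normal_form (T : theory) (sigma : nat -> nat) (t : sterm) : fterm :=
  let NI := num_funs (th_num T) in
  seval NI (ind_funs NI (th_ind T)) sigma FVar t.

Definition problem : Type := (theory * seq sterm)%type.

Definition unifiable (p : problem) : Prop :=
  forall sigma : nat -> nat,
    fo_unifiable [seq normal_form p.1 sigma t | t <- p.2].

(* The signature consisting of 0_iota (name 0, arity 0) and suc (name 1,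
   arity 1). *)
Definition num_sig (f k : nat) : bool := (f < 2) && (k == f).

Definition numeral (k : nat) : fterm := iter k (fun t => FFun 1 [:: t]) (FFun 0 [::]).

(* Schematic terms over a theory of primitive recursive definitions whose only
   first-order function symbols are 0_iota and suc, all individual arguments
   being terms of the same kind, hence without individual variables. *)
Definition PRL_term (T : theory) (t : sterm) : bool :=
  wf_sterm num_sig (nars (th_num T)) (iars (th_ind T)) pred0 predT t.

Definition PRL (p : problem) : bool :=
  wf_theory num_sig p.1 && all (PRL_term p.1) p.2.

Inductive rfun : Type :=
| RZero
| RSucc
| RProj (i : nat)
| RComp (f : rfun) (gs : seq rfun)
| RPrec (f g : rfun)
| RMu (f : rfun).

(* [reval f v y]: the partial function f is defined at v, with value y. *)
Inductive reval : rfun -> seq nat -> nat -> Prop :=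
| reval_zero v : reval RZero v 0
| reval_succ x : reval RSucc [:: x] x.+1
| reval_proj i v : i < size v -> reval (RProj i) v (nth 0 v i)
| reval_comp f gs v ws y :
    size ws = size gs ->
    (forall i, i < size gs -> reval (nth RZero gs i) v (nth 0 ws i)) ->
    reval f ws y -> reval (RComp f gs) v y
| reval_prec0 f g v y : reval f v y -> reval (RPrec f g) (0 :: v) y
| reval_precS f g n v y z :
    reval (RPrec f g) (n :: v) y -> reval g [:: n, y & v] z ->
    reval (RPrec f g) (n.+1 :: v) z
| reval_mu f v n (w : nat -> nat) :
    (forall k, k < n -> reval f (k :: v) (w k).+1) ->
    reval f (n :: v) 0 -> reval (RMu f) v n.

Definition cpair (x y : nat) : nat := ((x + y) * (x + y).+1)./2 + x.

Fixpoint code_seq (s : seq nat) : nat :=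
  if s is x :: s' then (cpair x (code_seq s')).+1 else 0.

Fixpoint code_nterm (t : nterm) : nat :=
  match t with
  | NZero => cpair 0 0
  | NSucc t => cpair 1 (code_nterm t)
  | NPar n => cpair 2 n
  | NApp f args => cpair 3 (cpair f (code_seq [seq code_nterm a | a <- args]))
  end.

Fixpoint code_sterm (t : sterm) : nat :=
  match t with
  | SVar x => cpair 0 x
  | SFun f args => cpair 1 (cpair f (code_seq [seq code_sterm a | a <- args]))
  | SApp t ss rs =>
      cpair 2 (cpair t (cpair (code_seq [seq code_sterm s | s <- ss])
                              (code_seq [seq code_nterm r | r <- rs])))
  end.

Definition code_ndef (d : ndef) : nat :=
  cpair (nd_arity d) (cpair (code_nterm (nd_base d)) (code_nterm (nd_step d))).

Definition code_idef (d : idef) : nat :=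
  cpair (cpair (id_iarity d) (id_narity d))
        (cpair (code_sterm (id_base d)) (code_sterm (id_step d))).

Definition code_theory (T : theory) : nat :=
  cpair (code_seq (map code_ndef (th_num T)))
        (code_seq (map code_idef (th_ind T))).

Definition code (p : problem) : nat :=
  cpair (code_theory p.1) (code_seq (map code_sterm p.2)).

(* The algorithm [d] answers 1 or 0; it may behave arbitrarily on numbers that
   are not codes of instances in PRL. *)
Definition decides_PRL_unification (d : rfun) : Prop :=
  forall p : problem, PRL p ->
    (unifiable p -> reval d [:: code p] 1) /\
    (~ unifiable p -> reval d [:: code p] 0).

Lemma cpair_inj x y x' y' : cpair x y = cpair x' y' -> x = x' /\ y = y'.
Proof.
have tri n : ((n * n.+1)./2 + n).+1 = (n.+1 * n.+2)./2.
  have -> : n.+1 * n.+2 = n * n.+1 + n.+1.*2 by rewrite -muln2 [n * _]mulnC -mulnDr addn2.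
  by rewrite halfD odd_double andbF doubleK addnS.
have mono a b : a < b -> (a * a.+1)./2 + a < (b * b.+1)./2.
  move=> ab; rewrite tri half_leq // leq_mul //.
rewrite /cpair => e.
have lt a b c d : a + b < c + d ->
    ((a + b) * (a + b).+1)./2 + a < ((c + d) * (c + d).+1)./2 + c.
  move=> /mono h; apply: leq_trans (leq_addr _ _); apply: leq_trans h.
  by rewrite ltnS leq_add2l leq_addr.
have es : x + y = x' + y'.
  by case: (ltngtP (x + y) (x' + y')) => // /lt; rewrite e ltnn.
move: e; rewrite es => /addnI exx; split=> //.
by move: es; rewrite exx => /addnI.
Qed.

Lemma nterm_nested_ind (P : nterm -> Prop) :
  P NZero -> (forall t, P t -> P (NSucc t)) -> (forall n, P (NPar n)) ->
  (forall f args, (forall a, List.In a args -> P a) -> P (NApp f args)) ->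
  forall t, P t.
Proof.
move=> P0 PS PP PA; fix IH 1; case=> [|t|n|f args].
- exact: P0.
- exact/PS/IH.
- exact: PP.
- by apply: PA; elim: args => [b []|a s IHs b [<-|/IHs]].
Qed.

Lemma sterm_nested_ind (P : sterm -> Prop) :
  (forall x, P (SVar x)) ->
  (forall f args, (forall a, List.In a args -> P a) -> P (SFun f args)) ->
  (forall t ss rs, (forall a, List.In a ss -> P a) -> P (SApp t ss rs)) ->
  forall t, P t.
Proof.
move=> PV PF PA; fix IH 1; case=> [x|f args|t ss rs].
- exact: PV.
- by apply: PF; elim: args => [b []|a s IHs b [<-|/IHs]].
- by apply: PA; elim: ss => [b []|a s IHs b [<-|/IHs]].
Qed.

Lemma code_seq_map_inj (A : Type) (g : A -> nat) (s s' : seq A) :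
  (forall a, List.In a s -> forall b, g a = g b -> a = b) ->
  code_seq (map g s) = code_seq (map g s') -> s = s'.
Proof.
elim: s s' => [|a s IHs] [|b s'] //= gI [] /cpair_inj [eab ess].
rewrite (gI a (or_introl erefl) _ eab); congr cons.
by apply: IHs ess => c cs; apply: gI; right.
Qed.

Lemma code_nterm_inj : injective code_nterm.
Proof.
elim/nterm_nested_ind => [|t IH|n|f args IH] [|t'|n'|f' args'] //= /cpair_inj [] //.
- by move=> _ /IH ->.
- by move=> _ ->.
- by move=> _ /cpair_inj [-> /code_seq_map_inj ->].
Qed.

Lemma code_sterm_inj : injective code_sterm.
Proof.
elim/sterm_nested_ind => [x|f args IH|t ss rs IH] [x'|f' args'|t' ss' rs'] //=
  /cpair_inj [] //.
- by move=> _ ->.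
- by move=> _ /cpair_inj [-> /code_seq_map_inj ->].
- move=> _ /cpair_inj [-> /cpair_inj [/code_seq_map_inj -> //]].
  by move=> /code_seq_map_inj -> // r _; exact: code_nterm_inj.
Qed.

Lemma code_inj : injective code.
Proof.
move=> [[D E] ts] [[D' E'] ts'] /cpair_inj [/cpair_inj [/= eD eE] /= ets].
rewrite (code_seq_map_inj _ eD) => [|[j b s] _ [j' b' s']]; last first.
  by move=> /cpair_inj [/= -> /cpair_inj [/code_nterm_inj -> /code_nterm_inj ->]].
rewrite (code_seq_map_inj _ eE) => [|[i j b s] _ [i' j' b' s']]; last first.
  move=> /cpair_inj [/cpair_inj [/= -> ->]].
  by move=> /cpair_inj [/code_sterm_inj -> /code_sterm_inj ->].
by rewrite (code_seq_map_inj _ ets) // => t _; exact: code_sterm_inj.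
Qed.

Definition is_numeral (t : fterm) : Prop := exists k, t = numeral k.

Definition numeral_fun (F : seq fterm -> seq nat -> fterm) (i : nat) : Prop :=
  forall xs v, size xs = i -> (forall x, List.In x xs -> is_numeral x) ->
    is_numeral (F xs v).

Lemma In_nth (A : Type) (d : A) s i : i < size s -> List.In (nth d s i) s.
Proof. by elim: s i => [//|a s IH] [|i] /= h; [left | right; apply: IH]. Qed.

Lemma all_In (A : Type) (a : pred A) s x : all a s -> List.In x s -> a x.
Proof. by elim: s => [//|y s IH] /= /andP [ay /IH h] [<-|/h]. Qed.

Lemma In_map (A B : Type) (g : A -> B) s y :
  List.In y (map g s) -> exists2 x, y = g x & List.In x s.
Proof.
elim: s => [//|a s IH] /= [<-|/IH [x -> xs]]; first by exists a => //; left.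
by exists x => //; right.
Qed.

Lemma seval_numeral NI II ns ia (X P : pred nat) sigma rho t :
  size II = size ia ->
  (forall k, k < size ia ->
     numeral_fun (nth (fun _ _ => FVar 0) II k) (nth (0, 0) ia k).1) ->
  (forall x, X x -> is_numeral (rho x)) ->
  wf_sterm num_sig ns ia X P t -> is_numeral (seval NI II sigma rho t).
Proof.
move=> sII hII hrho; elim/sterm_nested_ind: t => [x|f args IH|t ss rs IH] /=.
- exact: hrho.
- move=> /andP [/andP [f2 /eqP sa] wa].
  case: f args IH f2 sa wa => [|[|f]] [|a [|b args]] //= IH _ _; first by exists 0.
  by rewrite andbT => wa; have [k ->] := IH a (or_introl erefl) wa; exists k.+1.
- move=> /and4P [lt /eqP sz ws wr]; apply: hII => //; first by rewrite size_map -sz.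
  by move=> y yin; have [s -> ss'] := In_map yin; apply: IH => //; apply: all_In ss'.
Qed.

Lemma ind_funs_numeral NI D E :
  wf_defs (wf_idef num_sig D) [::] E ->
  size (ind_funs NI E) = size (iars E) /\
  forall k, k < size (iars E) ->
    numeral_fun (nth (fun _ _ => FVar 0) (ind_funs NI E) k) (nth (0, 0) (iars E) k).1.
Proof.
rewrite /ind_funs.
suff gen pre II : size II = size (iars pre) ->
   (forall k, k < size (iars pre) ->
     numeral_fun (nth (fun _ _ => FVar 0) II k) (nth (0, 0) (iars pre) k).1) ->
   wf_defs (wf_idef num_sig D) pre E ->
   let II' := foldl (fun II d => rcons II (idef_fun NI II d)) II E in
   size II' = size (iars (pre ++ E)) /\
   forall k, k < size (iars (pre ++ E)) ->
    numeral_fun (nth (fun _ _ => FVar 0) II' k) (nth (0, 0) (iars (pre ++ E)) k).1.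
  by move=> wE; apply: (gen [::] [::]).
elim: E pre II => [|d E IH] pre II sII hII /=; first by rewrite cats0.
move=> /andP [/andP [wb ws] wE]; rewrite -cat_rcons.
apply: IH => //; first by rewrite size_rcons sII !size_map size_rcons.
move=> k; rewrite /iars map_rcons size_rcons !nth_rcons ltnS -/(iars pre) sII.
rewrite leq_eqVlt orbC; case: ltnP => [kl _|_ /= /eqP ->]; first exact: hII.
rewrite eqxx /= => xs v sxs hxs; rewrite /idef_fun.
elim: (nth 0 v _) => [|m IHm] /=.
- apply: (seval_numeral _ _ sII hII _ wb) => x xi.
  by apply/hxs/In_nth; rewrite sxs; exact: xi.
- apply: (seval_numeral _ _ sII hII _ ws) => x xi.
  have xle : x < (size xs).+1 by rewrite sxs.
  rewrite nth_cat; case: ltnP => [xlt|xge]; first exact/hxs/In_nth.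
  have -> : x = size xs by apply/eqP; rewrite eqn_leq xge -ltnS xle.
  by rewrite subnn /=.
Qed.

Theorem PRL_numeral T t sigma :
  wf_theory num_sig T -> PRL_term T t -> exists k, normal_form T sigma t = numeral k.
Proof.
move=> /andP [_ wE] wt.
have [sI hI] := ind_funs_numeral (num_funs (th_num T)) wE.
exact: (seval_numeral _ _ sI hI _ wt).
Qed.

Fixpoint mu_free (f : rfun) : bool :=
  match f with
  | RZero | RSucc | RProj _ => true
  | RComp f gs => mu_free f && all mu_free gs
  | RPrec f g => mu_free f && mu_free g
  | RMu _ => false
  end.

Fixpoint nsubst (th : nat -> nterm) (t : nterm) : nterm :=
  match t with
  | NZero => NZero
  | NSucc t => NSucc (nsubst th t)
  | NPar n => th n
  | NApp f args => NApp f [seq nsubst th a | a <- args]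
  end.

Lemma eq_map_In (A B : Type) (g h : A -> B) s :
  (forall a, List.In a s -> g a = h a) -> map g s = map h s.
Proof.
by elim: s => [//|a s IH] /= e; rewrite e ?IH //; [move=> b bs; apply: e; right | left].
Qed.

Lemma all_In_intro (A : Type) (a : pred A) s :
  (forall x, List.In x s -> a x) -> all a s.
Proof.
by elim: s => [//|x s IH] /= h; rewrite h ?IH //; [move=> y ys; apply: h; right | left].
Qed.

Lemma neval_subst NI sigma th t :
  neval NI sigma (nsubst th t) = neval NI (fun n => neval NI sigma (th n)) t.
Proof.
elim/nterm_nested_ind: t => [|t IH|n|f args IH] //=; first by rewrite IH.
by rewrite -map_comp; congr (nth _ _ _ _); apply: eq_map_In.
Qed.

Lemma wf_nsubst ars (P Q : pred nat) th t :
  (forall n, P n -> wf_nterm ars Q (th n)) ->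
  wf_nterm ars P t -> wf_nterm ars Q (nsubst th t).
Proof.
move=> hth; elim/nterm_nested_ind: t => [|t IH|n|f args IH] //=; first exact: hth.
move=> /and3P [-> sz wa]; rewrite size_map sz all_map /=.
by apply: all_In_intro => a ain; apply: IH => //; apply: all_In ain.
Qed.

Lemma neval_ext NI ars (P : pred nat) s1 s2 t :
  (forall n, P n -> s1 n = s2 n) -> wf_nterm ars P t ->
  neval NI s1 t = neval NI s2 t.
Proof.
move=> e; elim/nterm_nested_ind: t => [|t IH|n|f args IH] //=.
- by move=> /IH ->.
- exact: e.
- move=> /and3P [_ _ wa]; congr (nth _ _ _ _); apply: eq_map_In => a ain.
  by apply: IH => //; apply: all_In ain.
Qed.

Lemma num_funs_rcons D d :
  num_funs (rcons D d) = rcons (num_funs D) (ndef_fun (num_funs D) d).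
Proof. by rewrite /num_funs foldl_rcons. Qed.

Lemma size_num_funs D : size (num_funs D) = size D.
Proof. by elim/last_ind: D => [//|D d IH]; rewrite num_funs_rcons !size_rcons IH. Qed.

Lemma num_funs_cat D E k : k < size D ->
  nth (fun=> 0) (num_funs (D ++ E)) k = nth (fun=> 0) (num_funs D) k.
Proof.
move=> kD; elim/last_ind: E => [|E d IH]; first by rewrite cats0.
rewrite -rcons_cat num_funs_rcons nth_rcons size_num_funs size_cat.
by rewrite (leq_trans kD (leq_addr _ _)).
Qed.

Lemma wf_nterm_cat D E P t :
  wf_nterm (nars D) P t -> wf_nterm (nars (D ++ E)) P t.
Proof.
elim/nterm_nested_ind: t => [|t IH|n|f args IH] //= /and3P [fD sz wa].
rewrite /nars map_cat size_cat nth_cat fD sz (leq_trans fD (leq_addr _ _)) -map_cat /=.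
by apply: all_In_intro => a ain; apply: IH => //; apply: all_In ain.
Qed.

Lemma neval_cat D E P sigma t : wf_nterm (nars D) P t ->
  neval (num_funs (D ++ E)) sigma t = neval (num_funs D) sigma t.
Proof.
elim/nterm_nested_ind: t => [|t IH|n|f args IH] //=; first by move=> /IH ->.
rewrite size_map => /and3P [fD sz wa]; rewrite num_funs_cat //.
by congr (nth _ _ _ _); apply: eq_map_In => a ain; apply: IH => //; apply: all_In ain.
Qed.

Lemma wf_defs_rcons A (ok : seq A -> A -> bool) pre s d :
  wf_defs ok pre (rcons s d) = wf_defs ok pre s && ok (pre ++ s) d.
Proof.
elim: s pre => [|e s IH] pre /=; first by rewrite cats0 andbT.
by rewrite IH cat_rcons andbA.
Qed.

Lemma rfun_nested_ind (P : rfun -> Prop) :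
  P RZero -> P RSucc -> (forall i, P (RProj i)) ->
  (forall f gs, P f -> (forall g, List.In g gs -> P g) -> P (RComp f gs)) ->
  (forall f g, P f -> P g -> P (RPrec f g)) -> (forall f, P f -> P (RMu f)) ->
  forall f, P f.
Proof.
move=> PZ PS PJ PC PR PM; fix IH 1; case=> [||i|f gs|f g|f].
- exact: PZ.
- exact: PS.
- exact: PJ.
- by apply: PC; [exact: IH | elim: gs => [b []|a s IHs b [<-|/IHs]]].
- by apply: PR; exact: IH.
- by apply: PM; exact: IH.
Qed.

Lemma mu_free_nterm f : mu_free f -> forall k D, wf_defs wf_ndef [::] D ->
  exists E t, [/\ wf_defs wf_ndef [::] (D ++ E),
    wf_nterm (nars (D ++ E)) (fun n => n < k) t &
    forall v y, size v = k -> reval f v y ->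
      neval (num_funs (D ++ E)) (nth 0 v) t = y].
Proof.
elim/rfun_nested_ind: f => [||i|f gs IHf IHgs|f g IHf IHg|//] /= fr k D wD.
- by exists [::], NZero; split; rewrite ?cats0 // => v y _ h; inversion h.
- case: k => [|k].
    by exists [::], NZero; split; rewrite ?cats0 // => -[|x v] y // _ h; inversion h.
  by exists [::], (NSucc (NPar 0)); split; rewrite ?cats0 // => v y _ h; inversion h.
- have [ik|ki] := ltnP i k.
    by exists [::], (NPar i); split; rewrite ?cats0 // => v y _ h; inversion h.
  exists [::], NZero; split; rewrite ?cats0 // => v y sv h.
  by inversion h as [| |i' v' iv| | | |]; move: iv; rewrite sv ltnNge ki.
- move: fr => /andP [ff fgs].
  have [E [ts [wE sts wts hts]]] : exists E ts, [/\ wf_defs wf_ndef [::] (D ++ E),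
      size ts = size gs, all (wf_nterm (nars (D ++ E)) (fun n => n < k)) ts &
      forall i v y, i < size gs -> size v = k -> reval (nth RZero gs i) v y ->
      neval (num_funs (D ++ E)) (nth 0 v) (nth NZero ts i) = y].
    elim: gs IHgs fgs => [|g gs IH] IHgs /=.
      by exists [::], [::]; split; rewrite ?cats0.
    move=> /andP [fg fgs].
    have [|E [ts [wE sts wts hts]]] := IH _ fgs; first by move=> h hin; apply: IHgs; right.
    have [E' [t [wE' wt ht]]] := IHgs g (or_introl erefl) fg k _ wE.
    rewrite -catA in wE' wt ht.
    exists (E ++ E'), (t :: ts); split=> //=; first by rewrite sts.
      rewrite wt /= catA; apply: all_In_intro => a ain.
      by apply: wf_nterm_cat; apply: all_In ain.
    case=> [|i] v y /=; first by move=> _; exact: ht.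
    move=> i_lt sv h; rewrite catA (neval_cat _ _ (P := fun n => n < k)); first exact: hts.
    by apply: all_In wts _; apply: In_nth; rewrite sts.
  have [E' [t [wE' wt ht]]] := IHf ff (size gs) _ wE.
  rewrite -catA in wE' wt ht.
  exists (E ++ E'), (nsubst (nth NZero ts) t); split=> //.
    apply: wf_nsubst wt => n n_lt; rewrite catA; apply: wf_nterm_cat.
    by apply: all_In wts _; apply: In_nth; rewrite sts.
  move=> v y sv h; inversion h as [| | |f' gs' v' ws y' sws hws hf| | |]; subst.
  rewrite neval_subst -(ht _ _ sws hf); apply: neval_ext wt => n n_lt.
  rewrite catA (neval_cat _ _ (P := fun n => n < size v)); first exact: hts (hws _ n_lt).
  by apply: all_In wts _; apply: In_nth; rewrite sts.
- move: fr => /andP [ff fg].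
  case: k => [|k].
    by exists [::], NZero; split; rewrite ?cats0 // => -[|x v] y // _ h; inversion h.
  have [E [tf [wE wtf htf]]] := IHf ff k _ wD.
  have [E' [tg [wE' wtg htg]]] := IHg fg k.+2 _ wE.
  rewrite -catA in wE' wtg htg; set F := D ++ E ++ E' in wE' wtg htg.
  pose th n := match n with 0 => NPar k | 1 => NPar k.+1 | n.+2 => NPar n end.
  pose d := NDef k tf (nsubst th tg).
  have wtf' : wf_nterm (nars F) (fun n => n < k) tf by rewrite /F catA; apply: wf_nterm_cat.
  have sF : size (nars F) = size F by rewrite size_map.
  exists (E ++ E' ++ [:: d]), (NApp (size F) (rcons (map NPar (iota 1 k)) (NPar 0))).
  have eF : D ++ E ++ E' ++ [:: d] = rcons F d by rewrite -cats1 /F !catA.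
  rewrite eF; split.
  + rewrite wf_defs_rcons wE' /= /wf_ndef /= wtf' /=.
    by apply: wf_nsubst wtg => -[|[|n]] //= n_lt; rewrite !ltnS in n_lt *; exact: leq_trans (ltnW n_lt) (leqnSn _).
  + rewrite /= /nars map_rcons size_rcons nth_rcons -/(nars F) sF ltnSn ltnn eqxx /=.
    rewrite size_rcons size_map size_iota eqxx all_rcons /= all_map.
    by apply/allP => n; rewrite mem_iota /= add1n => /andP [].
  + move=> [|x v] y //= [sv].
    rewrite num_funs_rcons nth_rcons size_num_funs ltnn eqxx.
    rewrite map_rcons -map_comp /=.
    have -> : [seq (neval (rcons (num_funs F) (ndef_fun (num_funs F) d)) (nth 0 (x :: v))
                   \o NPar) i | i <- iota 1 k] = v.
      apply: (@eq_from_nth _ 0); rewrite size_map size_iota ?sv // => i ik.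
      by rewrite (nth_map 0) ?size_iota // nth_iota.
    rewrite /ndef_fun /= -sv -cats1 take_size_cat // nth_cat ltnn subnn /=.
    elim: x y => [|x IH] y h; inversion h as [| | | |f' g' v' y' hf|f' g' n' v' y' z' hp hg|]; subst.
      rewrite /= /F catA (neval_cat _ _ (P := fun n => n < size v)) //; exact: htf.
    rewrite /= (IH _ hp) neval_subst -(htg _ _ _ hg) //.
    apply: neval_ext wtg => -[|[|n]] /= n_lt; rewrite nth_cat.
    * by rewrite ltnn subnn.
    * by rewrite ltnNge leqnSn /= subSnn.
    * by rewrite -[n < size v]/(n.+2 < (size v).+2) n_lt.
Qed.

(* Every primitive recursive function of arity [k] is represented by a PRL term
   in the parameters 0, .., k-1. *)
Theorem PRL_represents f k : mu_free f ->
  exists T t, [/\ wf_theory num_sig T, PRL_term T t &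
    forall sigma y, reval f [seq sigma n | n <- iota 0 k] y ->
      normal_form T sigma t = numeral y].
Proof.
move=> ff; have [D [t [wD wt ht]]] := @mu_free_nterm f ff k [::] isT.
rewrite !cat0s in wD wt ht.
pose num := IDef 1 0 (SFun 0 [::]) (SFun 1 [:: SVar 1]).
exists (Theory D [:: num]), (SApp 0 [:: SFun 0 [::]] [:: t]); split.
- by rewrite /wf_theory wD.
- rewrite /PRL_term /= andbT -[t](_ : nsubst NPar t = t).
    by apply: wf_nsubst wt.
  by elim/nterm_nested_ind: {wt ht} t => [|t|n|g args IH] //= => [-> //|];
     rewrite (eq_map_In IH) map_id.
- move=> sigma y /ht; rewrite size_map size_iota => /(_ erefl) e.
  rewrite /normal_form /= /idef_fun /= (@neval_ext _ (nars D) (fun n => n < k) _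
     (nth 0 [seq sigma n | n <- iota 0 k])) ?e //.
    by elim: y {e} => [//|y IH]; rewrite /= IH.
  by move=> n nk; rewrite (nth_map 0) ?size_iota // nth_iota.
Qed.

(* Main.v *)
(* Suppose d decides the problem.  Running d with a bounded number n of
   unbounded-search steps is a primitive recursive function of n and of the
   input, hence is representable by a schematic symbol.  Numerals allow a
   theory T to receive its own code as an argument, so there is an instance p
   over T, consisting of one term and the constant 0, whose term evaluates
   under sigma to 1 if the run of d on the code of p bounded by sigma(0) answers
   1, and to 0 otherwise.  Thus p is unifiable iff d does not answer 1 on it. *)
From mathcomp Require Import all_boot.
Require Import Defs.

Set Implicit Arguments.
Unset Strict Implicit.
Unset Printing Implicit Defensive.

(** * Closure properties of primitive recursive functions *)

(** Only lists of length [k] constrain [F]; [mu_free] is what later allows a schematic symbol to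
    represent it. *)
Definition prim k (F : seq nat -> nat) : Prop :=
  exists2 f, mu_free f & forall v, size v = k -> reval f v (F v).

Definition primv k l (W : seq nat -> seq nat) : Prop :=
  (forall v, size v = k -> size (W v) = l) /\
  (forall i, i < l -> prim k (fun v => nth 0 (W v) i)).

Lemma eq_prim k F G : (forall v, size v = k -> F v = G v) -> prim k F -> prim k G.
Proof. by move=> e [f ff hf]; exists f => // v sv; rewrite -e //; apply: hf. Qed.

Lemma finite_choice (A : Type) (a0 : A) (P : nat -> A -> Prop) l :
  (forall i, i < l -> exists a, P i a) ->
  exists2 s, size s = l & forall i, i < l -> P i (nth a0 s i).
Proof.
elim: l => [|l IH] h; first by exists [::].
have [s ss hs] := IH (fun i il => h i (ltnW il)).
have [a ha] := h l (leqnn _).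
exists (rcons s a); first by rewrite size_rcons ss.
move=> i; rewrite nth_rcons ss ltnS leq_eqVlt => /predU1P [->|il].
  by rewrite ltnn eqxx.
by rewrite il; apply: hs.
Qed.

Lemma prim_comp k l W F : primv k l W -> prim l F -> prim k (fun v => F (W v)).
Proof.
move=> [sW hW] [f ff hf].
have [|gs sgs hgs] := @finite_choice _ RZero (fun i g => mu_free g /\
    forall v, size v = k -> reval g v (nth 0 (W v) i)) l.
  by move=> i /hW [g fg hg]; exists g.
exists (RComp f gs) => /=.
  by rewrite ff; apply/(all_nthP RZero) => i; rewrite sgs => /hgs [].
move=> v sv; apply: (reval_comp (ws := W v)); first by rewrite sW.
  by move=> i; rewrite sgs => /hgs [_]; apply.
exact/hf/sW.
Qed.

Lemma primv_nil k : primv k 0 (fun=> [::]).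
Proof. by []. Qed.

Lemma primv_id k : primv k k id.
Proof.
split=> // i ik; exists (RProj i) => // v sv.
by apply: reval_proj; rewrite sv.
Qed.

Lemma primv_cons k l A W :
  prim k A -> primv k l W -> primv k l.+1 (fun v => A v :: W v).
Proof.
move=> hA [sW hW]; split=> [v sv|[|i]] //=; first by rewrite sW.
exact: hW.
Qed.

Lemma primv_behead k l W : primv k l.+1 W -> primv k l (fun v => behead (W v)).
Proof.
move=> [sW hW]; split=> [v sv|i il]; first by rewrite size_behead sW.
by apply: eq_prim (hW i.+1 il) => v sv; rewrite nth_behead.
Qed.

Lemma prim_nth k i : i < k -> prim k (fun v => nth 0 v i).
Proof. by move=> ik; apply: (primv_id k).2. Qed.

Lemma prim_succ k A : prim k A -> prim k (fun v => (A v).+1).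
Proof.
move=> hA; apply: (@prim_comp k 1 (fun v => [:: A v]) (fun v => (nth 0 v 0).+1)).
  exact: primv_cons hA (primv_nil k).
by exists RSucc => // -[|x [|y v]] //= _; apply: reval_succ.
Qed.

Lemma prim_const k c : prim k (fun=> c).
Proof.
elim: c => [|c IH]; last exact: prim_succ IH.
by exists RZero => // v _; apply: reval_zero.
Qed.

Lemma prim_rec k N F G : prim k N -> prim k F -> prim k.+2 G ->
  prim k (fun v => nat_rec (fun=> nat) (F v) (fun m r => G [:: m, r & v]) (N v)).
Proof.
move=> hN [f ff hf] [g fg hg].
apply: (@prim_comp k k.+1 (fun v => N v :: v) (fun v => nat_rec (fun=> nat)
   (F (behead v)) (fun m r => G [:: m, r & behead v]) (nth 0 v 0))).
  exact: primv_cons hN (primv_id k).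
exists (RPrec f g); rewrite /= ?ff // => -[|n v] //= [sv].
elim: n => [|n IH] /=; first exact/reval_prec0/hf.
by apply: reval_precS IH _; apply: hg; rewrite /= sv.
Qed.

Lemma prim_if0 k A B C : prim k A -> prim k B -> prim k C ->
  prim k (fun v => if A v == 0 then B v else C v).
Proof.
move=> hA hB hC.
apply: (@eq_prim _ (fun v => nat_rec (fun=> nat) (B v) (fun m r => C v) (A v))).
  by move=> v _; case: (A v).
apply: (@prim_rec _ _ _ (fun w => C (behead (behead w)))) => //.
by apply: prim_comp hC; do 2!apply: primv_behead; apply: primv_id.
Qed.

Lemma prim_pred k A : prim k A -> prim k (fun v => (A v).-1).
Proof.
move=> hA; apply: (@eq_prim _ (fun v => nat_rec (fun=> nat) 0 (fun m _ => m) (A v))).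
  by move=> v _; case: (A v).
apply: (@prim_rec _ _ _ (fun w => nth 0 w 0)) => //; first exact: prim_const.
exact: prim_nth.
Qed.

Lemma prim_add k A B : prim k A -> prim k B -> prim k (fun v => A v + B v).
Proof.
move=> hA hB.
apply: (@eq_prim _ (fun v => nat_rec (fun=> nat) (A v) (fun _ r => r.+1) (B v))).
  by move=> v _; elim: (B v) => [|b /= ->]; rewrite ?addn0 ?addnS.
apply: (@prim_rec _ _ _ (fun w => (nth 0 w 1).+1)) => //.
exact/prim_succ/prim_nth.
Qed.

(** Multiplication and halving are bypassed: consecutive triangular numbers differ by [m.+1]. *)
Lemma prim_triangular k A : prim k A -> prim k (fun v => (A v * (A v).+1)./2).
Proof.
move=> hA; apply: (@eq_prim _
    (fun v => nat_rec (fun=> nat) 0 (fun m r => (r + m).+1) (A v))).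
  move=> v _; elim: (A v) => [//|n IH]; rewrite [LHS]/= IH.
  have -> : n.+1 * n.+2 = n * n.+1 + n.+1.*2.
    by rewrite -muln2 [n * _]mulnC -mulnDr addn2.
  by rewrite halfD odd_double andbF doubleK addnS.
apply: (@prim_rec _ _ _ (fun w => (nth 0 w 1 + nth 0 w 0).+1)) => //.
  exact: prim_const.
by apply/prim_succ/prim_add; apply: prim_nth.
Qed.

Lemma prim_cpair k A B : prim k A -> prim k B -> prim k (fun v => cpair (A v) (B v)).
Proof.
by move=> hA hB; apply: prim_add => //; apply: prim_triangular; apply: prim_add.
Qed.

Definition nnum (a : nat) : nterm := iter a NSucc NZero.

(** Self-reference rests on this map: it passes from a number to the code of the term denoting
    it. *)
Lemma prim_code_nnum k A : prim k A -> prim k (fun v => code_nterm (nnum (A v))).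
Proof.
move=> hA; apply: (@eq_prim _
    (fun v => nat_rec (fun=> nat) (cpair 0 0) (fun _ r => cpair 1 r) (A v))).
  by move=> v _; elim: (A v) => [|n /= ->].
apply: (@prim_rec _ _ _ (fun w => cpair 1 (nth 0 w 1))) => //.
  exact: prim_const.
by apply: prim_cpair; [apply: prim_const | apply: prim_nth].
Qed.

(** * Bounded evaluation of partial recursive functions *)

(* The value 0 stands for "undefined within the bound" and y.+1 for the value
   y.  The bound n limits the range of each unbounded search; in the state of
   such a search 0 means "still searching", 1 "undefined", and k.+2 "found k". *)
Fixpoint bounded_eval (d : rfun) (n : nat) (v : seq nat) : nat :=
  match d with
  | RZero => 1
  | RSucc => if size v == 1 then (nth 0 v 0).+2 else 0
  | RProj i => if i < size v then (nth 0 v i).+1 else 0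
  | RComp f gs =>
      if all (fun g => bounded_eval g n v != 0) gs
      then bounded_eval f n [seq (bounded_eval g n v).-1 | g <- gs] else 0
  | RPrec f g =>
      if v is x :: u then
        nat_rec (fun=> nat) (bounded_eval f n u)
          (fun m r => if r == 0 then 0 else bounded_eval g n [:: m, r.-1 & u]) x
      else 0
  | RMu f =>
      (nat_rec (fun=> nat) 0 (fun k s =>
         if s == 0 then
           if bounded_eval f n (k :: v) == 0 then 1
           else if (bounded_eval f n (k :: v)).-1 == 0 then k.+2 else 0
         else s) n).-1
  end.

(** The first clause concerns every bound, so that short runs cannot give a wrong answer. *)
Definition settles (b : nat -> nat) (y : nat) : Prop :=
  (forall n, b n = 0 \/ b n = y.+1) /\
  exists n0, forall n, n0 <= n -> b n = y.+1.

Lemma uniform_bound (Q : nat -> nat -> Prop) m :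
  (forall i, i < m -> exists n0, forall n, n0 <= n -> Q i n) ->
  exists n0, forall n, n0 <= n -> forall i, i < m -> Q i n.
Proof.
elim: m => [|m IH] h; first by exists 0.
have [n0 h0] := IH (fun i im => h i (ltnW im)).
have [n1 h1] := h m (leqnn _).
exists (maxn n0 n1) => n; rewrite geq_max => /andP [le0 le1] i.
by rewrite ltnS leq_eqVlt => /predU1P [->|]; [apply: h1 | apply: h0].
Qed.

(** Induction on the derivation: finitely many subcomputations settle beyond a common bound, and in
    shorter runs an undefined one that is consulted makes the whole undefined. *)
Lemma reval_settles d v y : reval d v y -> settles (fun n => bounded_eval d n v) y.
Proof.
elim=> {d v y} [v|x|i v iv|f gs v ws y sws _ IHgs _ [IHf1 [nf IHf2]]
  |f g v y _ IH|f g n v y z _ [IHy1 [ny IHy2]] _ [IHg1 [ng IHg2]]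
  |f v n w _ IHw _ [IHn1 [nn IHn2]]].
- by split=> [n|]; [right | exists 0].
- by split=> [n|]; [right | exists 0].
- by rewrite /settles /= iv; split=> [n|]; [right | exists 0].
- have args n : all (fun g => bounded_eval g n v != 0) gs ->
      [seq (bounded_eval g n v).-1 | g <- gs] = ws.
    move=> /(all_nthP RZero) nz.
    apply: (@eq_from_nth _ 0); rewrite size_map // => i ig.
    rewrite (nth_map RZero) //; have [/(_ n) [e|->] _] := IHgs i ig => //.
    by move: (nz i ig); rewrite e.
  split=> [n|] /=.
    by case: ifP => [/args -> //|_]; left.
  have [n0 h0] := uniform_bound (fun i ig => (IHgs i ig).2).
  exists (maxn n0 nf) => n; rewrite geq_max => /andP [le0 lef].
  have nz : all (fun g => bounded_eval g n v != 0) gs.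
    by apply/(all_nthP RZero) => i ig; rewrite h0.
  by rewrite nz args // IHf2.
- exact: IH.
- split=> [m|] /=.
    have /= [->|->] := IHy1 m; first by left.
    exact: IHg1.
  exists (maxn ny ng) => m; rewrite geq_max => /andP [ley leg].
  by have /= -> := IHy2 m ley; apply: IHg2.
- pose st m := nat_rec (fun=> nat) 0 (fun k s =>
     if s == 0 then
       if bounded_eval f m (k :: v) == 0 then 1
       else if (bounded_eval f m (k :: v)).-1 == 0 then k.+2 else 0
     else s).
  (* The state [st m k] reflects the candidates below [k]; those below [n] have nonzero values, so
     the search cannot succeed early. *)
  have before m k : k <= n -> st m k = 0 \/ st m k = 1.
    elim: k => [|k IH] kn /=; first by left.
    have [->|->] := IH (ltnW kn); last by right.
    by have [/(_ m) [->|->] _] := IHw k kn; [right | left].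
  have after m k : n < k -> st m k = 1 \/ st m k = n.+2.
    elim: k => // k IH; rewrite ltnS leq_eqVlt => /predU1P [<-|/IH [] /= ->].
    + have /= [->|->] := before m n (leqnn _); last by left.
      by have [->|->] := IHn1 m; [left | right].
    + by left.
    + by right.
  split=> [m|] /=.
    rewrite -/(st m m); have [mn|nm] := leqP m n; first by have [->|->] := before m m mn; left.
    by have [->|->] := after m m nm; [left | right].
  have [n0 h0] := uniform_bound (fun i ig => (IHw i ig).2).
  (* Exceeding [n] ensures that candidate [n] itself is tried. *)
  exists (maxn n.+1 (maxn n0 nn)) => m; rewrite !geq_max => /and3P [nm le0 len].
  have search k : k <= n -> st m k = 0.
    elim: k => [//|k IH] kn /=; rewrite IH ?(ltnW kn) //=.
    by rewrite (h0 m le0 k kn).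
  have found k : n < k -> st m k = n.+2.
    elim: k => // k IH; rewrite ltnS leq_eqVlt => /predU1P [<-|/IH /= -> //].
    by rewrite /= search //= IHn2.
  by rewrite -/(st m m) found.
Qed.

Lemma prim_bounded_eval_comp k l d N U :
  prim l.+1 (fun w => bounded_eval d (nth 0 w 0) (behead w)) ->
  prim k N -> primv k l U -> prim k (fun v => bounded_eval d (N v) (U v)).
Proof.
move=> hd hN hU.
by apply: (prim_comp (W := fun v => N v :: U v)) hd; apply: primv_cons.
Qed.

(** Searches are bounded and [d] is fixed, so induction on the syntax of [d] suffices; no evaluator
    uniform in [d] is involved. *)
Lemma prim_bounded_eval d k :
  prim k.+1 (fun w => bounded_eval d (nth 0 w 0) (behead w)).
Proof.
elim/rfun_nested_ind: d k => [||i|f gs IHf IHgs|f g IHf IHg|f IHf] k /=.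
- exact: prim_const.
- have [->|k1] := eqVneq k 1.
    apply: (@eq_prim _ (fun w => (nth 0 w 1).+2)).
      by move=> [|n [|x []]].
    by do 2!apply: prim_succ; apply: prim_nth.
  apply: eq_prim (prim_const _ 0) => w sw.
  by rewrite size_behead sw (negPf k1).
- have [ik|ki] := ltnP i k.
    apply: (@eq_prim _ (fun w => (nth 0 w i.+1).+1)).
      by move=> w sw; rewrite size_behead sw ik nth_behead.
    by apply/prim_succ/prim_nth.
  by apply: eq_prim (prim_const _ 0) => w sw; rewrite size_behead sw ltnNge ki.
- pose X w := bounded_eval f (nth 0 w 0)
    [seq (bounded_eval g (nth 0 w 0) (behead w)).-1 | g <- gs].
  have hX : prim k.+1 X.
    apply: (prim_bounded_eval_comp (IHf (size gs))); first exact: prim_nth.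
    elim: gs IHgs {X} => [|g gs IH] IHgs /=; first exact: primv_nil.
    apply: primv_cons; first by apply/prim_pred/IHgs; left.
    by apply: IH => h hin; apply: IHgs; right.
  change (prim k.+1 (fun w =>
    if all (fun g => bounded_eval g (nth 0 w 0) (behead w) != 0) gs
    then X w else 0)).
  (* The guard is treated by a second induction on [gs]; the body of [X] mentions [gs] too, so it is
     forgotten first. *)
  move: X hX => X hX {IHf}; elim: gs IHgs => [|g gs IH] IHgs //=.
  apply: (@eq_prim _ (fun w =>
    if bounded_eval g (nth 0 w 0) (behead w) == 0 then 0
    else if all (fun h => bounded_eval h (nth 0 w 0) (behead w) != 0) gs
         then X w else 0)); first by move=> w _; case: eqP.
  apply: prim_if0; [by apply: IHgs; left | exact: prim_const |].
  by apply: IH => h hin; apply: IHgs; right.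
- case: k => [|k].
    by apply: eq_prim (prim_const _ 0) => -[|n []].
  apply: (@eq_prim _ (fun w => nat_rec (fun=> nat)
     (bounded_eval f (nth 0 w 0) (behead (behead w)))
     (fun m r => if r == 0 then 0 else
        bounded_eval g (nth 0 w 0) [:: m, r.-1 & behead (behead w)]) (nth 0 w 1))).
    by move=> [|n [|x u]].
  (* In [w] the counter and the previous value precede the bound, the recursion argument and the
     remaining arguments. *)
  apply: (@prim_rec _ _ _ (fun w => if nth 0 w 1 == 0 then 0 else
     bounded_eval g (nth 0 w 2)
       [:: nth 0 w 0, (nth 0 w 1).-1 & behead (behead (behead (behead w)))])).
  + exact: prim_nth.
  + apply: (prim_bounded_eval_comp (IHf k)); first exact: prim_nth.
    by do 2!apply: primv_behead; apply: primv_id.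
  + apply: prim_if0; [exact: prim_nth | exact: prim_const |].
    apply: (prim_bounded_eval_comp (IHg k.+2)); first exact: prim_nth.
    apply: primv_cons; first exact: prim_nth.
    apply: primv_cons; first exact/prim_pred/prim_nth.
    by do 4!apply: primv_behead; apply: primv_id.
- apply: prim_pred.
  have hf : prim k.+3 (fun w => bounded_eval f (nth 0 w 2)
       (nth 0 w 0 :: behead (behead (behead w)))).
    apply: (prim_bounded_eval_comp (IHf k.+1)); first exact: prim_nth.
    apply: primv_cons; first exact: prim_nth.
    by do 3!apply: primv_behead; apply: primv_id.
  apply: (@prim_rec _ _ _ (fun w => if nth 0 w 1 == 0 then
     if bounded_eval f (nth 0 w 2) (nth 0 w 0 :: behead (behead (behead w))) == 0
     then 1 else
     if (bounded_eval f (nth 0 w 2) (nth 0 w 0 :: behead (behead (behead w)))).-1 == 0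
     then (nth 0 w 0).+2 else 0 else nth 0 w 1)).
  + exact: prim_nth.
  + exact: prim_const.
  + apply: prim_if0; [exact: prim_nth | | exact: prim_nth].
    apply: prim_if0; [exact: hf | exact: prim_const |].
    apply: prim_if0; [exact/prim_pred/hf | | exact: prim_const].
    by do 2!apply: prim_succ; apply: prim_nth.
Qed.

(** * The self-referential instance *)

(** Here [a] is to be the code of the theory and [b] the position of a symbol in it; [NPar 0] bounds
    the run, and the final [NZero] selects the base case of that symbol. *)
Definition diag_term (a b : nat) : sterm :=
  SApp 0 [::] [:: NApp b [:: NPar 0; nnum a; nnum b; NZero]].

(** The theory enters only through its code, so this is primitive recursive in two numbers. *)
Definition diag_code (a b : nat) : nat :=
  cpair a (code_seq [:: code_sterm (diag_term a b); code_sterm (SFun 0 [::])]).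

Lemma prim_diag_code k A B : prim k A -> prim k B ->
  prim k (fun v => diag_code (A v) (B v)).
Proof.
move=> hA hB; rewrite /diag_code /=.
by repeat first [exact: prim_const | exact: prim_code_nnum | assumption
                | apply: prim_cpair | apply: prim_succ].
Qed.

(** No substitution can identify a successor with the constant. *)
Lemma fo_unifiable_numeral0 y :
  fo_unifiable [:: numeral y; FFun 0 [::]] <-> y = 0.
Proof.
split=> [[theta /(_ _ _ (or_introl erefl) (or_intror (or_introl erefl)))]|->].
  by case: y.
by exists FVar => t u [<-|[<-|[]]] [<-|[<-|[]]].
Qed.

Lemma neval_nnum NI sigma a : neval NI sigma (nnum a) = a.
Proof. by elim: a => [//|a /= ->]. Qed.

Lemma wf_nnum ars P a : wf_nterm ars P (nnum a).
Proof. by elim: a. Qed.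

(** There is no circularity: [F] becomes a symbol taking [a] and [b] as arguments, and the code of
    the finished theory is then written into the term only, not into the definitions. *)
Lemma diagonal_instance F : prim 3 F ->
  exists p a b, [/\ PRL p, code p = diag_code a b &
    unifiable p <-> forall n, F [:: n; a; b] = 0].
Proof.
move=> [f ff hf]; have [E [t [wE wt ht]]] := @mu_free_nterm f ff 3 [::] isT.
rewrite !cat0s in wE wt ht.
(* The recursion argument is dummy: it makes a symbol out of the term [t]. *)
pose D := rcons E (NDef 3 t NZero).
(* The single symbol of sort iota turns a number into its numeral. *)
pose T := Theory D [:: IDef 0 0 (SFun 0 [::]) (SFun 1 [:: SVar 0])].
pose a := code_theory T; pose b := size E.
exists (T, [:: diag_term a b; SFun 0 [::]]), a, b; split=> //.
  rewrite /PRL /wf_theory /= wf_defs_rcons wE /wf_ndef /= wt /= /PRL_term /=.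
  rewrite !wf_nnum /nars map_rcons size_rcons nth_rcons size_map.
  by rewrite ltnSn ltnn eqxx.
have nf sigma : normal_form T sigma (diag_term a b) = numeral (F [:: sigma 0; a; b]).
  rewrite /normal_form /diag_term [LHS]/= /idef_fun /= !neval_nnum.
  rewrite num_funs_rcons nth_rcons size_num_funs ltnn eqxx /ndef_fun /=.
  rewrite (ht [:: sigma 0; a; b] _ erefl (hf [:: sigma 0; a; b] erefl)).
  by elim: (F _) => [//|y /= ->].
split=> [u n|e sigma].
  by have := u (fun=> n); rewrite /= nf => /fo_unifiable_numeral0.
by rewrite /= nf; apply/fo_unifiable_numeral0.
Qed.

Theorem theorem4 : ~ exists d : rfun, decides_PRL_unification d.
Proof.
move=> [d dec].
(* As [y.+1] encodes the answer [y], a zero predecessor means the answer 0; any larger answer is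
   counted as 1. *)
pose answers1 n x := if bounded_eval d n [:: x] == 0 then 0
  else if (bounded_eval d n [:: x]).-1 == 0 then 0 else 1.
pose F w := answers1 (nth 0 w 0) (diag_code (nth 0 w 1) (nth 0 w 2)).
have primF : prim 3 F.
  have hd : prim 3 (fun w => bounded_eval d (nth 0 w 0)
      [:: diag_code (nth 0 w 1) (nth 0 w 2)]).
    apply: (prim_bounded_eval_comp (prim_bounded_eval d 1)); first exact: prim_nth.
    apply: primv_cons (primv_nil _).
    by apply: prim_diag_code; apply: prim_nth.
  apply: prim_if0 => //; first exact: prim_const.
  by apply: prim_if0; [apply: prim_pred | exact: prim_const | exact: prim_const].
have [p [a [b [Pp cp up]]]] := diagonal_instance primF.
have [yes no] := dec p Pp; rewrite cp in yes no.
(* Unifiability is not decided by cases: the answer 1 would make [F] nonzero at some bound, which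
   refutes unifiability; then [d] answers 0, so [F] vanishes at every bound and [p] is unifiable. *)
have nu : ~ unifiable p.
  move=> u; have [_ [n hn]] := reval_settles (yes u).
  by move: (up.1 u n); rewrite /F /answers1 /= (hn n (leqnn _)).
apply/nu/up => n; have [h0 _] := reval_settles (no nu).
by rewrite /F /answers1 /=; have [->|->] := h0 n.
Qed.
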